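(* Let $G$ be a bipartite cubic graph. If $G$ has a Hist, then $|V(G)| \equiv 2 \pmod 4$.
   Context: All graphs are finite and simple. A cubic graph is a $3$-regular graph. A Hist (homeomorphically irreducible spanning tree) of a connected graph $G$ is a spanning tree of $G$ which has no vertex of degree two (degree taken in the tree). *)

(* Defs.v *)
From mathcomp Require Import all_boot.

Set Implicit Arguments.
Unset Strict Implicit.
Unset Printing Implicit Defensive.

(* A finite simple graph on the vertex set V is its adjacency
   relation, and a spanning subgraph is another relation on the same V. *)

Section Graphs.

Variable V : finType.
Implicit Types e t : rel V.

Definition simple_graph e : Prop := symmetric e /\ irreflexive e.

Definition degree e (x : V) : nat := #|[set y | e x y]|.

Definition cubic e : Prop := forall x : V, degree e x = 3.

(* The two colour classes are A and ~: A; either may be empty. *)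
Definition bipartite e : Prop :=
  exists A : {set V}, forall x y : V, e x y -> (x \in A) != (y \in A).

(* The graph with no vertex is not connected. *)
Definition connected_graph e : Prop :=
  0 < #|V| /\ forall x y : V, connect e x y.

(* [ucycle] also accepts x, y with x adjacent to y, which is not a cycle of a
   simple graph, hence the bound on the length. *)
Definition acyclic e : Prop :=
  forall c : seq V, 2 < size c -> ~ ucycle e c.

Definition tree e : Prop :=
  [/\ simple_graph e, connected_graph e & acyclic e].

Definition spanning_tree e t : Prop := subrel t e /\ tree t.

Definition hist e t : Prop :=
  spanning_tree e t /\ forall x : V, degree t x <> 2.

Definition has_hist e : Prop := exists t : rel V, hist e t.

End Graphs.

(* Main.v *)
(** If the colour classes of [G] are [A] and [B], then [3|A| = |E(G)| = 3|B|],
so [|V| = 2|A|].  Every edge of the Hist [T] has exactly one end in [A], so the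
degrees in [T] of the vertices of [A] add up to [|V| - 1], which is odd.  These
degrees are 1 or 3, hence the sum has the parity of [|A|], and [|A|] is odd. *)

Require Import Defs.
From mathcomp Require Import all_boot.
From mathcomp Require Import zify.

Set Implicit Arguments.
Unset Strict Implicit.
Unset Printing Implicit Defensive.

Section SumDegree.

Variable V : finType.
Implicit Types (e : rel V) (A : {set V}).

Lemma degreeE e x : degree e x = \sum_y e x y.
Proof. by rewrite /degree cardsE -sum1_card big_mkcond. Qed.

(** Both sums count the edges, each by its end in one class. It serves for the graph and for its
    tree alike. *)
Lemma bipartite_sum_degree e A : symmetric e ->
    (forall x y, e x y -> (x \in A) != (y \in A)) ->
  \sum_(x in A) degree e x = \sum_(x in ~: A) degree e x.
Proof.
move=> e_sym eA.
have sum_across (B C : {set V}) : C = ~: B ->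
    (forall x y, e x y -> (x \in B) != (y \in B)) ->
    \sum_(x in B) degree e x = \sum_(x in B) \sum_(y in C) e x y.
  move=> -> eB; apply: eq_bigr => x xB; rewrite degreeE [RHS]big_mkcond /=.
  apply: eq_bigr => y _; rewrite in_setC.
  by case exy: (e x y); [move: (eB x y exy); rewrite xB; case: (y \in B) | case: ifP].
rewrite (sum_across A (~: A)) // (sum_across (~: A) A) ?setCK //; last first.
  by move=> x y /eA; rewrite !in_setC; case: (x \in A); case: (y \in A).
rewrite exchange_big /=.
by apply: eq_bigr => x _; apply: eq_bigr => y _; rewrite e_sym.
Qed.

End SumDegree.

Section Tree.

Variable V : finType.
Implicit Types (t : rel V) (r x y z : V).

(** Deletion of [x] that keeps the type [V]: [x] stays as an isolated vertex, whence the hypothesis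
    [y != x] below. *)
Definition avoid t x : rel V := [rel u v | [&& t u v, u != x & v != x]].

Lemma avoid_sym t x : symmetric t -> symmetric (avoid t x).
Proof. by move=> t_sym u v; rewrite /avoid /= t_sym [(u != x) && _]andbC. Qed.

Lemma path_avoid t x y p : y != x ->
  path (avoid t x) y p = path t y p && (x \notin p).
Proof.
elim: p y => //= z p IHp y y_x; rewrite {1}/avoid /= in_cons negb_or y_x /=.
rewrite [x == z]eq_sym; case: (eqVneq z x) => [->|z_x]; first by rewrite !andbF.
by rewrite andbT IHp // andbA.
Qed.

Lemma connect_avoidP t x y z : y != x ->
  reflect (exists p, [/\ path t y p, uniq (y :: p), x \notin p & last y p = z])
          (connect (avoid t x) y z).
Proof.
move=> y_x; apply: (iffP connectP) => [[p yp ->]|[p [yp _ x_p <-]]].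
  case/shortenP: yp => q yq uq _; exists q.
  by move: yq; rewrite path_avoid // => /andP[].
by exists p; rewrite ?path_avoid ?yp.
Qed.

(** A nonempty simple path from [y] to [z] off [x] would close up through [x] to a cycle of length
    at least 3. *)
Lemma acyclic_avoid t x y z : simple_graph t -> acyclic t ->
  t x y -> t x z -> connect (avoid t x) y z -> y = z.
Proof.
move=> [t_sym t_irr] t_acyc txy txz.
have y_x : y != x by apply: contraTneq txy => ->; rewrite t_irr.
case/(connect_avoidP _ _ y_x) => -[|v p] [yp up x_p last_p]; first by [].
case: (t_acyc [:: x, y, v & p]) => //; apply/andP; split.
  rewrite (cycle_path x) /=; move: last_p yp => /= -> /= ->.
  by rewrite txy t_sym txz.
by rewrite cons_uniq up in_cons negb_or eq_sym y_x x_p.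
Qed.

(* When [t] is a tree rooted at [r], this says that [y] is the parent of [x]. *)
Definition parent t r x y := t x y && connect (avoid t x) y r.

Lemma parent_root t r y : irreflexive t -> parent t r r y = false.
Proof.
move=> t_irr; apply/andP => -[try].
have y_r : y != r by apply: contraTneq try => ->; rewrite t_irr.
case/(connect_avoidP _ _ y_r) => p [_ _ r_p last_p].
by move: (mem_last y p); rewrite last_p in_cons eq_sym (negPf y_r) (negPf r_p).
Qed.

(** The parent is the second vertex of a simple path from [x] to [r]. *)
Lemma parent_exists t r x : connect t x r -> x != r ->
  exists y, parent t r x y.
Proof.
case/connectP=> p xp ->; case/shortenP: xp => -[|y q] /=; first by rewrite eqxx.
case/andP=> txy yq /andP[]; rewrite in_cons negb_or => /andP[x_y x_q] uq _ _.
exists y; rewrite /parent txy; apply/connect_avoidP; first by rewrite eq_sym.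
by exists q.
Qed.

Lemma parent_uniq t r x y z : simple_graph t -> acyclic t ->
  parent t r x y -> parent t r x z -> y = z.
Proof.
move=> t_simple t_acyc /andP[txy yr] /andP[txz zr].
apply: (acyclic_avoid t_simple t_acyc txy txz); apply: connect_trans yr _.
by rewrite (sym_connect_sym (avoid_sym _ t_simple.1)).
Qed.

(** This orients each edge towards the root in exactly one way. *)
Lemma parent_edge t r x y : tree t -> t x y ->
  parent t r x y + parent t r y x = 1.
Proof.
move=> [t_simple [_ t_conn] t_acyc] txy; have [t_sym t_irr] := t_simple.
have y_x : y != x by apply: contraTneq txy => ->; rewrite t_irr.
have x_y : x != y by rewrite eq_sym.
have tyx : t y x by rewrite t_sym.
rewrite /parent txy tyx /=.
case: (boolP (connect (avoid t x) y r)) => [yr | not_yr].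
  (* Both orientations at once: either [y] is the root and has a parent, or the path from [y] to [r]
     off [x] starts with a second parent [z] of [y]. *)
  case: (boolP (connect (avoid t y) x r)) => // xr; exfalso.
  case/(connect_avoidP _ _ y_x): (yr) => -[|z p] [].
    move=> _ _ _ /= y_r.
    by move: (parent_root r x t_irr); rewrite /parent -{1 2}y_r tyx xr.
  move=> /= /andP[tyz zp] /andP[]; rewrite !in_cons !negb_or.
  move=> /andP[y_z y_p] up /andP[x_z x_p] last_p.
  have zr : connect (avoid t y) z r.
    by apply/connect_avoidP; [rewrite eq_sym | exists p].
  have := @parent_uniq t r y x z t_simple t_acyc.
  by rewrite /parent tyx tyz xr zr => /(_ isT isT) x_eq_z; rewrite x_eq_z eqxx in x_z.
(* Now every path from [y] to [r] meets [x]; the part of a simple one after [x] avoids [y]. *)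
suff -> : connect (avoid t y) x r by [].
case/connectP: (t_conn y r) not_yr => p yp ->.
case/shortenP: yp => q yq uq _ not_yr.
have x_q : x \in q.
  by apply: contraNT not_yr => x_q; apply/connect_avoidP => //; exists q.
case/splitPr: x_q yq uq {not_yr} => q1 q2.
rewrite cat_path /= cat_uniq mem_cat in_cons !negb_or last_cat /=.
move=> /and3P[_ _ xq2] /andP[/and3P[_ _ y_q2] /and3P[_ _ uq2]].
by apply/connect_avoidP => //; exists q2.
Qed.

(** Fix a root [r]. Each vertex but [r] has one parent, and each ordered adjacent pair is
    child-parent or parent-child, never both. *)
Lemma tree_sum_degree t : tree t -> \sum_x degree t x = (#|V|.-1).*2.
Proof.
move=> t_tree; have [t_simple [/card_gt0P[r _] t_conn] t_acyc] := t_tree.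
have one_parent x : \sum_y parent t r x y = (x != r).
  have [->|x_r] := eqVneq x r.
    by rewrite big1 // => y _; rewrite (parent_root _ _ t_simple.2).
  have [y xy] := parent_exists (t_conn x r) x_r.
  rewrite (bigD1 y) //= xy big1 // => z z_y.
  apply/eqP; rewrite eqb0; apply: contra z_y => xz.
  by rewrite (parent_uniq t_simple t_acyc xz xy).
have sum_parent : \sum_x \sum_y parent t r x y = #|V|.-1.
  under eq_bigr do rewrite one_parent.
  by rewrite -big_mkcond sum1_card -(cardC1 r); apply: eq_card.
have ->: \sum_x degree t x = \sum_x \sum_y (parent t r x y + parent t r y x).
  apply: eq_bigr => x _; rewrite degreeE; apply: eq_bigr => y _.
  case txy: (t x y); first by rewrite parent_edge.
  by rewrite /parent (t_simple.1 y x) txy.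
under eq_bigr do rewrite big_split.
by rewrite big_split /= [X in _ + X]exchange_big /= sum_parent addnn.
Qed.

End Tree.

Theorem corollary3 (V : finType) (e : rel V) (hG : simple_graph e)
    (hbip : bipartite e) (hcub : cubic e) (hhist : has_hist e) :
  #|V| = 2 %[mod 4].
Proof.
have [A eA] := hbip; have [t [[t_e t_tree] t_deg2]] := hhist.
have [[t_sym t_irr] [V_gt0 t_conn] _] := t_tree.
have deg_odd x : odd (degree t x).
  have deg_le3 : degree t x <= 3.
    by rewrite -(hcub x); apply: subset_leq_card; apply/subsetP=> y;
       rewrite !inE; apply: t_e.
  suff : 0 < degree t x by have := t_deg2 x; lia.
  (* A neighbour of [x] in [e] supplies a vertex other than [x]; with the tree rooted there, [x] has
     a parent. *)
  have /card_gt0P[y] : 0 < degree e x by rewrite hcub.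
  rewrite inE => exy; have x_y : x != y.
    by apply: contraTneq exy => ->; rewrite hG.2.
  have [z /andP[txz _]] := parent_exists (t_conn x y) x_y.
  by apply/card_gt0P; exists z; rewrite inE.
have sum_mod2 (B : {set V}) : odd (\sum_(x in B) degree t x) = odd #|B|.
  rewrite -sum1_card; elim/big_rec2: _ => // x m n _ IH.
  by rewrite !oddD IH deg_odd.
have cardA : #|A| = #|~: A|.
  move: (bipartite_sum_degree hG.1 eA).
  rewrite !(eq_bigr (fun=> 3) (fun x _ => hcub x)).
  rewrite !sum_nat_const; lia.
have tA x y : t x y -> (x \in A) != (y \in A) by move/t_e/eA.
have := bipartite_sum_degree t_sym tA; have := tree_sum_degree t_tree.
rewrite (bigID (mem A)) /= => sum_t sum_tA.
have sumC : \sum_(x | x \notin A) degree t x = \sum_(x in ~: A) degree t x.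
  by apply: eq_bigl => x; rewrite in_setC.
move: sum_t (sum_mod2 A) (cardsC A) V_gt0; rewrite sumC -sum_tA -cardA.
(* Here [s + s = 2(n - 1)], [a + a = n], and [s] and [a] have the same parity; [0 < n] excludes
   [n = 0], where the predecessor is truncated. *)
by move: (\sum_(x in A) _) #|A| #|V| => s a n; clear; lia.
Qed.
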